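(* Let $n\ge1$ be an integer and let $(\mathcal{S}_n,[\cdot,\cdot])$ be the Schrödinger algebra in $(n+1)$-dimensional space-time. If $n\neq2$, then all transposed Poisson structures on $(\mathcal{S}_n,[\cdot,\cdot])$ are trivial. If $n=2$, then, up to isomorphism, there is only one non-trivial transposed Poisson structure $\cdot$ on $(\mathcal{S}_2,[\cdot,\cdot])$, and it is given by $$s_{12}\cdot s_{12}=z,$$ with all other products of basis elements (from the basis $f,h,e,z,x_1,y_1,x_2,y_2,s_{12}$) equal to zero.
   Context: For an integer $n\ge1$, the Schrödinger algebra $\mathcal{S}_n$ is the complex Lie algebra with basis $\{e,f,h,z,x_i,y_i,s_{jk}\mid 1\le i\le n,\ 1\le j<k\le n\}$, with the convention $s_{kj}=-s_{jk}$ (so $s_{jj}=0$), and brackets $[e,f]=h$, $[h,e]=2e$, $[f,h]=2f$, $[x_i,y_i]=z$, $[h,x_i]=x_i$, $[h,y_i]=-y_i$, $[e,y_i]=x_i$, $[f,x_i]=y_i$, $[s_{jk},x_i]=\delta_{ki}x_j-\delta_{ji}x_k$, $[s_{jk},y_i]=\delta_{ki}y_j-\delta_{ji}y_k$, $[s_{jk},s_{lm}]=\delta_{lk}s_{jm}+\delta_{jm}s_{kl}+\delta_{mk}s_{lj}+\delta_{lj}s_{mk}$, where $\delta$ is the Kronecker delta; all brackets of basis elements not determined by these relations and antisymmetry are zero. (For $n=1$ there are no elements $s_{jk}$.) A transposed Poisson structure on a complex Lie algebra $(\mathcal{L},[\cdot,\cdot])$ is a bilinear, commutative and associative multiplication $\cdot$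 on $\mathcal{L}$ such that $2w\cdot[x,y]=[w\cdot x,y]+[x,w\cdot y]$ for all $x,y,w\in\mathcal{L}$. It is called trivial if the multiplication $\cdot$ is identically zero. Two transposed Poisson structures $\cdot$ and $\cdot'$ on $(\mathcal{L},[\cdot,\cdot])$ are isomorphic if there is a Lie algebra automorphism $\phi$ of $\mathcal{L}$ with $\phi(u\cdot v)=\phi(u)\cdot'\phi(v)$ for all $u,v\in\mathcal{L}$. *)

(* Defs.v *)
From HB Require Import structures.
From mathcomp Require Import all_boot all_order all_algebra.
From mathcomp Require Import ring.
From mathcomp Require Import complex.
From mathcomp Require Import reals.

Set Implicit Arguments.
Unset Strict Implicit.
Unset Printing Implicit Defensive.

Import Order.TTheory GRing.Theory Num.Theory.
Local Open Scope ring_scope.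

HB.mixin Record Lmodule_isLieAlgebra (K : fieldType) L of GRing.Lmodule K L := {
  lie : L -> L -> L;
  lie_linearl : forall v, linear (lie^~ v);
  lie_linearr : forall u, linear (lie u);
  lie_alt : forall u, lie u u = 0;
  lie_jacobi : forall u v w,
    lie u (lie v w) + lie v (lie w u) + lie w (lie u v) = 0
}.

#[short(type="lieAlgType")]
HB.structure Definition LieAlgebra (K : fieldType) :=
  { L of GRing.Lmodule K L & Lmodule_isLieAlgebra K L }.

Record transposed_poisson (K : fieldType) (L : lieAlgType K) := TransposedPoisson {
  tp_mul :> L -> L -> L;
  tp_linearl : forall v, linear (tp_mul^~ v);
  tp_linearr : forall u, linear (tp_mul u);
  tp_commutative : commutative tp_mul;
  tp_associative : associative tp_mul;
  tp_compat : forall x y w,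
    2 *: tp_mul w (lie x y) = lie (tp_mul w x) y + lie x (tp_mul w y)
}.

Definition tp_trivial (K : fieldType) (L : lieAlgType K)
    (m : transposed_poisson L) : Prop :=
  forall u v, m u v = 0.

Definition lie_automorphism (K : fieldType) (L : lieAlgType K)
    (phi : {linear L -> L}) : Prop :=
  bijective phi /\ forall u v, phi (lie u v) = lie (phi u) (phi v).

Definition tp_isomorphic (K : fieldType) (L : lieAlgType K)
    (m m' : transposed_poisson L) : Prop :=
  exists2 phi : {linear L -> L},
    lie_automorphism phi & forall u v, phi (m u v) = m' (phi u) (phi v).

(* The mathematical indices 1, ..., n are represented by 0, ..., n - 1. *)
Inductive sch_index (n : nat) : Type :=
  | IE | IF | IH | IZ
  | IX of 'I_n
  | IY of 'I_n
  | IS (j k : 'I_n) of (j < k)%N.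

Arguments IE {n}.
Arguments IF {n}.
Arguments IH {n}.
Arguments IZ {n}.

Section SchIndexFinite.
Variable n : nat.

Definition sch_index_code : Type :=
  ('I_4 + 'I_n + 'I_n + {p : 'I_n * 'I_n | (p.1 < p.2)%N})%type.

Definition sch_index_encode (a : sch_index n) : sch_index_code :=
  match a with
  | IE => inl (inl (inl (inord 0)))
  | IF => inl (inl (inl (inord 1)))
  | IH => inl (inl (inl (inord 2)))
  | IZ => inl (inl (inl (inord 3)))
  | IX i => inl (inl (inr i))
  | IY i => inl (inr i)
  | IS j k lt_jk => inr (exist _ (j, k) lt_jk)
  end.

Definition sch_index_decode (c : sch_index_code) : sch_index n :=
  match c with
  | inl (inl (inl i)) => nth IE [:: IE; IF; IH; IZ] i
  | inl (inl (inr i)) => IX i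
  | inl (inr i) => IY i
  | inr (exist p lt_p) => IS lt_p
  end.

Lemma sch_index_encodeK : cancel sch_index_encode sch_index_decode.
Proof. by case=> //=; rewrite inordK. Qed.

End SchIndexFinite.

HB.instance Definition _ n :=
  Countable.copy (sch_index n) (can_type (@sch_index_encodeK n)).
HB.instance Definition _ n : isFinite (sch_index n) :=
  CanIsFinite (@sch_index_encodeK n).

Definition schrodinger (K : fieldType) (n : nat) : Type :=
  {ffun sch_index n -> K^o}.

HB.instance Definition _ (K : fieldType) n :=
  GRing.Lmodule.on (schrodinger K n).

(* The Jacobi identity on basis vectors is checked over an abstract module V,
   with scalar coordinate functions so that ring applies: on the concrete
   function space the same case analysis is prohibitively slow. *)
Section BasisJacobi.
Variables (K : fieldType) (V : lmodType K) (I : Type) (n : nat).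
Variable coord : I -> V -> K.
Hypothesis coordD : forall t u v, coord t (u + v) = coord t u + coord t v.
Hypothesis coordZ : forall t c u, coord t (c *: u) = c * coord t u.
Hypothesis coord_eq0 : forall u, (forall t, coord t u = 0) -> u = 0.
Variables (lie : V -> V -> V) (e f h z : V) (x y : 'I_n -> V) (s : 'I_n -> 'I_n -> V).
Hypothesis lieDl : forall u v w, lie (u + v) w = lie u w + lie v w.
Hypothesis lieZl : forall c u v, lie (c *: u) v = c *: lie u v.
Hypothesis lieC : forall u v, lie u v = - lie v u.
Hypothesis lie_alt : forall u, lie u u = 0.
Let d (i j : 'I_n) : K := (i == j)%:R.
Hypothesis sC : forall j k, s k j = - s j k.
Hypothesis lie_z : forall u, lie z u = 0.
Hypothesis lie_ef : lie e f = h.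
Hypothesis lie_he : lie h e = 2 *: e.
Hypothesis lie_fh : lie f h = 2 *: f.
Hypothesis lie_xx : forall i j, lie (x i) (x j) = 0.
Hypothesis lie_xy : forall i j, lie (x i) (y j) = d i j *: z.
Hypothesis lie_yy : forall i j, lie (y i) (y j) = 0.
Hypothesis lie_ex : forall i, lie e (x i) = 0.
Hypothesis lie_ey : forall i, lie e (y i) = x i.
Hypothesis lie_fx : forall i, lie f (x i) = y i.
Hypothesis lie_fy : forall i, lie f (y i) = 0.
Hypothesis lie_hx : forall i, lie h (x i) = x i.
Hypothesis lie_hy : forall i, lie h (y i) = - y i.
Hypothesis lie_se : forall j k, lie (s j k) e = 0.
Hypothesis lie_sf : forall j k, lie (s j k) f = 0.
Hypothesis lie_sh : forall j k, lie (s j k) h = 0.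
Hypothesis lie_sx : forall j k i, lie (s j k) (x i) = d k i *: x j - d j i *: x k.
Hypothesis lie_sy : forall j k i, lie (s j k) (y i) = d k i *: y j - d j i *: y k.
Hypothesis lie_ss : forall j k l m, lie (s j k) (s l m) =
    d l k *: s j m + d j m *: s k l + d m k *: s l j + d l j *: s m k.

Let jac u v w := lie u (lie v w) + lie v (lie w u) + lie w (lie u v).

Let lieDr u v w : lie u (v + w) = lie u v + lie u w.
Proof. by rewrite lieC lieDl opprD -!lieC. Qed.
Let lieZr c u v : lie u (c *: v) = c *: lie u v.
Proof. by rewrite lieC lieZl -scalerN -lieC. Qed.
Let lie0l u : lie 0 u = 0.
Proof. by rewrite -[0 in LHS](scale0r 0) lieZl scale0r. Qed.
Let lie0r u : lie u 0 = 0.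
Proof. by rewrite lieC lie0l oppr0. Qed.
Let lieNl u v : lie (- u) v = - lie u v.
Proof. by rewrite -scaleN1r lieZl scaleN1r. Qed.
Let lieNr u v : lie u (- v) = - lie u v.
Proof. by rewrite -scaleN1r lieZr scaleN1r. Qed.

Inductive kind : Type := KE | KF | KH | KZ | KX of 'I_n | KY of 'I_n | KS of 'I_n & 'I_n.
Definition kval a := match a with KE => e | KF => f | KH => h | KZ => z
  | KX i => x i | KY i => y i | KS j k => s j k end.
Definition krank a := match a with KE => 0 | KF => 1 | KH => 2 | KZ => 3
  | KX i => 4 | KY i => 5 | KS j k => 6 end%N.

Let jacC u v w : jac u v w = jac v w u.
Proof. by rewrite /jac -addrA addrC. Qed.
Let jacN u v w : jac u v w = - jac v u w.
Proof.
by rewrite /jac (lieC w v) (lieC u w) (lieC v u) !lieNr !opprD !opprK [in RHS](addrC (lie v _)).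
Qed.

Let kjac_sorted a b c : (krank a <= krank b)%N -> (krank b <= krank c)%N ->
  jac (kval a) (kval b) (kval c) = 0.
Proof.
have lie_zr u : lie u z = 0 by rewrite lieC lie_z oppr0.
have dC i j : d i j = d j i by rewrite /d eq_sym.
have coordN t u : coord t (- u) = - coord t u.
  by rewrite -scaleN1r coordZ mulN1r.
have coord0 t : coord t 0 = 0 by rewrite -[0 in LHS](scale0r 0) coordZ mul0r.
pose flipE := (lieC (x _) e, lieC (x _) f, lieC (x _) h,
  lieC (y _) e, lieC (y _) f, lieC (y _) h,
  lieC (x _) (s _ _), lieC (y _) (s _ _), lieC (y _) (x _),
  lieC e (s _ _), lieC f (s _ _), lieC h (s _ _), lieC e h, lieC f e, lieC h f,
  lie_alt, lie_zr, lie_z).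
pose valE := (lie_ef, lie_he, lie_fh, lie_xx, lie_xy, lie_yy, lie_ex, lie_ey, lie_fx,
    lie_fy, lie_hx, lie_hy, lie_se, lie_sf, lie_sh, lie_sx, lie_sy, lie_ss).
rewrite /jac.
case: a => [||||i1|i1|j1 k1]; case: b => [||||i2|i2|j2 k2] // _;
  case: c => [||||i3|i3|j3 k3] // _; rewrite /kval.
all: rewrite ?flipE.
all: rewrite ?lieNr ?valE.
all: rewrite ?(lieDr, lieZr, lieNr, lie0r).
all: rewrite ?flipE.
all: rewrite ?valE.
all: try by rewrite ?(scaler0, oppr0, addr0, addrN, addNr).
all: apply: coord_eq0 => t; rewrite ?(dC i3 i2) ?(dC j3 i2, dC k3 i2, dC j3 i1, dC k3 i1)
   ?(dC j2 i1, dC k2 i1)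
   ?(dC j3 j1, dC k3 j1, dC j3 k1, dC k3 k1, dC j2 j1, dC k2 j1, dC j2 k1, dC k2 k1)
   ?(dC j3 j2, dC k3 j2, dC j3 k2, dC k3 k2)
   ?(sC j1 j3, sC j1 k3, sC k1 j3, sC k1 k3, sC j1 j2, sC j1 k2, sC k1 j2, sC k1 k2,
      sC j2 j3, sC j2 k3, sC k2 j3, sC k2 k3).
all: rewrite !(coordD, coordN, coordZ, coord0); ring.
Qed.

Let kjac a b c : jac (kval a) (kval b) (kval c) = 0.
Proof.
have [ab|/ltnW ab] := leqP (krank a) (krank b);
  have [bc|/ltnW bc] := leqP (krank b) (krank c);
  have [ac|/ltnW ac] := leqP (krank a) (krank c).
- exact: kjac_sorted.
- exact: kjac_sorted.
- by rewrite jacN jacC kjac_sorted ?oppr0.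
- by rewrite jacC jacC kjac_sorted.
- by rewrite jacN kjac_sorted ?oppr0.
- by rewrite jacC kjac_sorted.
- by rewrite jacC jacN kjac_sorted ?oppr0.
- by rewrite jacC jacN kjac_sorted ?oppr0.
Qed.

Lemma basis_jacobi (J : finType) (b : J -> V) (code : J -> kind) :
    (forall j, b j = kval (code j)) ->
    (forall u, exists c : J -> K, u = \sum_j c j *: b j) ->
  forall u v w, jac u v w = 0.
Proof.
move=> b_code b_span.
have jac0 v w : jac 0 v w = 0 by rewrite /jac !(lie0l, lie0r) !addr0.
have jacD u1 u2 v w : jac (u1 + u2) v w = jac u1 v w + jac u2 v w.
  by rewrite /jac !(lieDl, lieDr) [RHS]addrACA; congr (_ + _); rewrite addrACA.
have jacZ c u v w : jac (c *: u) v w = c *: jac u v w.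
  by rewrite /jac !(lieZl, lieZr) !scalerDr.
have ext v w : (forall j, jac (b j) v w = 0) -> forall u, jac u v w = 0.
  move=> jb u; have [c ->] := b_span u.
  rewrite (big_morph (fun u => jac u v w) (fun u1 u2 => jacD u1 u2 v w) (jac0 v w)).
  by rewrite big1 // => j _; rewrite jacZ jb scaler0.
move=> u v w; move: u; apply: (ext) => j1; rewrite jacC.
move: v; apply: (ext) => j2; rewrite jacC.
move: w; apply: (ext) => j3; rewrite jacC !b_code.
exact: kjac.
Qed.

End BasisJacobi.

Section Schrodinger.
Variables (K : fieldType) (n : nat).
Implicit Types (a b : sch_index n) (i j k l m : 'I_n) (u v w : schrodinger K n).

Definition sch_base a : schrodinger K n := [ffun b => (a == b)%:R].

Definition sch_e : schrodinger K n := sch_base IE.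
Definition sch_f : schrodinger K n := sch_base IF.
Definition sch_h : schrodinger K n := sch_base IH.
Definition sch_z : schrodinger K n := sch_base IZ.
Definition sch_x i : schrodinger K n := sch_base (IX i).
Definition sch_y i : schrodinger K n := sch_base (IY i).

(* Only the s_jk with j < k are basis vectors; the others are given by the
   convention s_kj = - s_jk. *)
Definition sch_s j k : schrodinger K n :=
  match @idP (j < k)%N, @idP (k < j)%N with
  | ReflectT lt_jk, _ => sch_base (IS lt_jk)
  | _, ReflectT lt_kj => - sch_base (IS lt_kj)
  | _, _ => 0
  end.

Local Notation delta i j := ((i == j)%:R : K).

Definition sch_lie_base a b : schrodinger K n :=
  match a, b with
  | IE, IF => sch_h            | IF, IE => - sch_h
  | IH, IE => 2 *: sch_e       | IE, IH => - (2 *: sch_e)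
  | IF, IH => 2 *: sch_f       | IH, IF => - (2 *: sch_f)
  | IX i, IY j => delta i j *: sch_z
  | IY j, IX i => - (delta i j *: sch_z)
  | IH, IX i => sch_x i        | IX i, IH => - sch_x i
  | IH, IY i => - sch_y i      | IY i, IH => sch_y i
  | IE, IY i => sch_x i        | IY i, IE => - sch_x i
  | IF, IX i => sch_y i        | IX i, IF => - sch_y i
  | IS j k _, IX i => delta k i *: sch_x j - delta j i *: sch_x k
  | IX i, IS j k _ => - (delta k i *: sch_x j - delta j i *: sch_x k)
  | IS j k _, IY i => delta k i *: sch_y j - delta j i *: sch_y k
  | IY i, IS j k _ => - (delta k i *: sch_y j - delta j i *: sch_y k)
  | IS j k _, IS l m _ =>
      delta l k *: sch_s j m + delta j m *: sch_s k l
      + delta m k *: sch_s l j + delta l j *: sch_s m k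
  | _, _ => 0
  end.

Definition sch_lie u v : schrodinger K n :=
  \sum_a \sum_b (u a * v b) *: sch_lie_base a b.

Lemma sch_lie_linearl v : linear (sch_lie^~ v).
Proof.
move=> c u1 u2; rewrite /sch_lie scaler_sumr -big_split /=.
apply: eq_bigr => a _; rewrite scaler_sumr -big_split /=.
by apply: eq_bigr => b _; rewrite !ffunE scalerA -scalerDl mulrDl mulrA.
Qed.

Lemma sch_lie_linearr u : linear (sch_lie u).
Proof.
move=> c v1 v2; rewrite /sch_lie scaler_sumr -big_split /=.
apply: eq_bigr => a _; rewrite scaler_sumr -big_split /=.
apply: eq_bigr => b _; rewrite !ffunE scalerA -scalerDl mulrDr.
by rewrite mulrCA.
Qed.

Lemma sch_sC j k : sch_s k j = - sch_s j k.
Proof.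
rewrite /sch_s; case: {-}_ / idP => [kj|nkj]; case: {-}_ / idP => [jk|njk] //.
- by have := ltn_trans kj jk; rewrite ltnn.
- by rewrite opprK.
- by rewrite oppr0.
Qed.

Lemma sch_sE j k (lt_jk : (j < k)%N) : sch_s j k = sch_base (IS lt_jk).
Proof.
rewrite /sch_s; case: {-}_ / idP => [jk|//].
by rewrite (bool_irrelevance jk lt_jk).
Qed.

Lemma sch_s0 j : sch_s j j = 0.
Proof. by rewrite /sch_s; case: {-}_ / idP => // jj; have := jj; rewrite ltnn. Qed.

Lemma sch_lie_baseE a b : sch_lie (sch_base a) (sch_base b) = sch_lie_base a b.
Proof.
rewrite /sch_lie (bigD1 a) //= [X in _ + X]big1 ?addr0 => [|a' ne_a'].
  rewrite (bigD1 b) //= [X in _ + X]big1 ?addr0 => [|b' ne_b'].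
    by rewrite !ffunE !eqxx mulr1 scale1r.
  by rewrite !ffunE [b == _]eq_sym (negPf ne_b') mulr0 scale0r.
by rewrite big1 // => b' _; rewrite !ffunE [a == _]eq_sym (negPf ne_a') mul0r scale0r.
Qed.

Lemma sch_base_sum u : u = \sum_a u a *: sch_base a.
Proof.
apply/ffunP => b; rewrite sum_ffunE (bigD1 b) //= !ffunE eqxx [_ *: _]mulr1.
rewrite big1 ?addr0 // => a ne_ab.
by rewrite !ffunE (negPf ne_ab) [_ *: _]mulr0.
Qed.

Lemma sch_lie_baseC a b : sch_lie_base a b = - sch_lie_base b a.
Proof.
case: a => [||||i|i|j k lt_jk]; case: b => [||||i'|i'|l m lt_lm] //=;
  rewrite ?oppr0 ?opprK //.
rewrite !opprD -!scalerN -!sch_sC.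
rewrite [l == k]eq_sym [j == m]eq_sym [m == k]eq_sym [l == j]eq_sym.
by apply/ffunP => c; rewrite !ffunE; ring.
Qed.

Lemma sch_lie0l v : sch_lie 0 v = 0.
Proof. by have := sch_lie_linearl v (-1) 0 0; rewrite scaler0 addr0 scaleN1r addNr. Qed.

Lemma sch_lie0r u : sch_lie u 0 = 0.
Proof. by have := sch_lie_linearr u (-1) 0 0; rewrite scaler0 addr0 scaleN1r addNr. Qed.

Lemma sch_lieDl u v w : sch_lie (u + v) w = sch_lie u w + sch_lie v w.
Proof. by rewrite -[u]scale1r sch_lie_linearl !scale1r. Qed.

Lemma sch_lieDr u v w : sch_lie u (v + w) = sch_lie u v + sch_lie u w.
Proof. by rewrite -[v]scale1r sch_lie_linearr !scale1r. Qed.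

Lemma sch_lieZl c u v : sch_lie (c *: u) v = c *: sch_lie u v.
Proof. by rewrite -[c *: u]addr0 sch_lie_linearl sch_lie0l addr0. Qed.

Lemma sch_lieZr c u v : sch_lie u (c *: v) = c *: sch_lie u v.
Proof. by rewrite -[c *: v]addr0 sch_lie_linearr sch_lie0r addr0. Qed.

Lemma sch_lieNl u v : sch_lie (- u) v = - sch_lie u v.
Proof. by rewrite -scaleN1r sch_lieZl scaleN1r. Qed.

Lemma sch_lieNr u v : sch_lie u (- v) = - sch_lie u v.
Proof. by rewrite -scaleN1r sch_lieZr scaleN1r. Qed.

Lemma sch_lie_suml (I : finType) (F : I -> schrodinger K n) v :
  sch_lie (\sum_i F i) v = \sum_i sch_lie (F i) v.
Proof.
by apply: (big_morph (sch_lie^~ v)) => [u w|]; rewrite ?sch_lieDl ?sch_lie0l.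
Qed.

Lemma sch_lie_sumr (I : finType) u (F : I -> schrodinger K n) :
  sch_lie u (\sum_i F i) = \sum_i sch_lie u (F i).
Proof.
by apply: (big_morph (sch_lie u)) => [v w|]; rewrite ?sch_lieDr ?sch_lie0r.
Qed.

Lemma sch_lieC u v : sch_lie u v = - sch_lie v u.
Proof.
rewrite /sch_lie exchange_big -sumrN; apply: eq_bigr => a _.
rewrite -sumrN; apply: eq_bigr => b _.
by rewrite sch_lie_baseC scalerN mulrC.
Qed.

Lemma sch_s_ind (P : schrodinger K n -> 'I_n -> 'I_n -> Prop) :
    (forall j, P 0 j j) ->
    (forall j k, P (sch_s j k) j k -> P (- sch_s j k) k j) ->
    (forall j k (lt_jk : (j < k)%N), P (sch_base (IS lt_jk)) j k) ->
  forall j k, P (sch_s j k) j k.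
Proof.
move=> P0 PN Plt j k; case: (ltngtP j k) => [jk|kj|/val_inj<-].
- by rewrite sch_sE.
- by rewrite sch_sC; apply: PN; rewrite sch_sE.
- by rewrite sch_s0.
Qed.

Lemma sch_lie_ef : sch_lie sch_e sch_f = sch_h.
Proof. exact: sch_lie_baseE. Qed.

Lemma sch_lie_he : sch_lie sch_h sch_e = 2 *: sch_e.
Proof. exact: sch_lie_baseE. Qed.

Lemma sch_lie_fh : sch_lie sch_f sch_h = 2 *: sch_f.
Proof. exact: sch_lie_baseE. Qed.

Lemma sch_lie_xy i j : sch_lie (sch_x i) (sch_y j) = delta i j *: sch_z.
Proof. exact: sch_lie_baseE. Qed.

Lemma sch_lie_hx i : sch_lie sch_h (sch_x i) = sch_x i.
Proof. exact: sch_lie_baseE. Qed.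

Lemma sch_lie_hy i : sch_lie sch_h (sch_y i) = - sch_y i.
Proof. exact: sch_lie_baseE. Qed.

Lemma sch_lie_ex i : sch_lie sch_e (sch_x i) = 0.
Proof. exact: sch_lie_baseE. Qed.

Lemma sch_lie_ey i : sch_lie sch_e (sch_y i) = sch_x i.
Proof. exact: sch_lie_baseE. Qed.

Lemma sch_lie_fx i : sch_lie sch_f (sch_x i) = sch_y i.
Proof. exact: sch_lie_baseE. Qed.

Lemma sch_lie_fy i : sch_lie sch_f (sch_y i) = 0.
Proof. exact: sch_lie_baseE. Qed.

Lemma sch_lie_xx i j : sch_lie (sch_x i) (sch_x j) = 0.
Proof. exact: sch_lie_baseE. Qed.

Lemma sch_lie_yy i j : sch_lie (sch_y i) (sch_y j) = 0.
Proof. exact: sch_lie_baseE. Qed.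

Lemma sch_lie_zl u : sch_lie sch_z u = 0.
Proof.
rewrite (sch_base_sum u) sch_lie_sumr big1 // => a _.
by rewrite sch_lieZr sch_lie_baseE scaler0.
Qed.

Lemma sch_lie_zr u : sch_lie u sch_z = 0.
Proof. by rewrite sch_lieC sch_lie_zl oppr0. Qed.

Lemma sch_lie_sx j k i :
  sch_lie (sch_s j k) (sch_x i) = delta k i *: sch_x j - delta j i *: sch_x k.
Proof.
apply: (sch_s_ind (P := fun u j k => sch_lie u (sch_x i) =
  delta k i *: sch_x j - delta j i *: sch_x k)) => {j k} [j|j k|j k lt_jk].
- by rewrite sch_lie0l subrr.
- by rewrite sch_lieNl => ->; rewrite opprB.
- by rewrite sch_lie_baseE.
Qed.

Lemma sch_lie_sy j k i :
  sch_lie (sch_s j k) (sch_y i) = delta k i *: sch_y j - delta j i *: sch_y k.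
Proof.
apply: (sch_s_ind (P := fun u j k => sch_lie u (sch_y i) =
  delta k i *: sch_y j - delta j i *: sch_y k)) => {j k} [j|j k|j k lt_jk].
- by rewrite sch_lie0l subrr.
- by rewrite sch_lieNl => ->; rewrite opprB.
- by rewrite sch_lie_baseE.
Qed.

Lemma sch_lie_ss j k l m :
  sch_lie (sch_s j k) (sch_s l m) =
    delta l k *: sch_s j m + delta j m *: sch_s k l
    + delta m k *: sch_s l j + delta l j *: sch_s m k.
Proof.
apply: (sch_s_ind (P := fun u j k => sch_lie u (sch_s l m) =
    delta l k *: sch_s j m + delta j m *: sch_s k l
    + delta m k *: sch_s l j + delta l j *: sch_s m k))
  => {j k} [j|j k|j k lt_jk].
- rewrite sch_lie0l (sch_sC l j) (sch_sC j m) [m == j]eq_sym.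
  by apply/ffunP => c; rewrite !ffunE; ring.
- rewrite sch_lieNl => ->.
  rewrite (sch_sC k m) (sch_sC j l) (sch_sC l k) (sch_sC m j).
  rewrite [j == m]eq_sym [k == m]eq_sym.
  by apply/ffunP => c; rewrite !ffunE; ring.
apply: (sch_s_ind (P := fun u l m => sch_lie (sch_base (IS lt_jk)) u =
    delta l k *: sch_s j m + delta j m *: sch_s k l
    + delta m k *: sch_s l j + delta l j *: sch_s m k))
  => {l m} [l|l m|l m lt_lm].
- rewrite sch_lie0r (sch_sC l j) (sch_sC l k) [j == l]eq_sym.
  by apply/ffunP => c; rewrite !ffunE; ring.
- rewrite sch_lieNr => ->.
  rewrite (sch_sC m k) (sch_sC l k) (sch_sC m j) (sch_sC l j).
  rewrite [j == m]eq_sym [j == l]eq_sym.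
  by apply/ffunP => c; rewrite !ffunE; ring.
- by rewrite sch_lie_baseE.
Qed.

Lemma sch_lie_se j k : sch_lie (sch_s j k) sch_e = 0.
Proof.
apply: (sch_s_ind (P := fun u j k => sch_lie u sch_e = 0)) => {j k} [j|j k|j k lt_jk].
- by rewrite sch_lie0l.
- by rewrite sch_lieNl => ->; rewrite oppr0.
- by rewrite sch_lie_baseE.
Qed.

Lemma sch_lie_sf j k : sch_lie (sch_s j k) sch_f = 0.
Proof.
apply: (sch_s_ind (P := fun u j k => sch_lie u sch_f = 0)) => {j k} [j|j k|j k lt_jk].
- by rewrite sch_lie0l.
- by rewrite sch_lieNl => ->; rewrite oppr0.
- by rewrite sch_lie_baseE.
Qed.

Lemma sch_lie_sh j k : sch_lie (sch_s j k) sch_h = 0.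
Proof.
apply: (sch_s_ind (P := fun u j k => sch_lie u sch_h = 0)) => {j k} [j|j k|j k lt_jk].
- by rewrite sch_lie0l.
- by rewrite sch_lieNl => ->; rewrite oppr0.
- by rewrite sch_lie_baseE.
Qed.

Lemma sch_base_ind (P : schrodinger K n -> Prop) :
    P 0 -> (forall c u v, P u -> P v -> P (c *: u + v)) ->
    (forall a, P (sch_base a)) ->
  forall u, P u.
Proof.
move=> P0 PD Pb u; rewrite (sch_base_sum u); apply: (big_ind P) => // [v w Pv Pw|a _].
  by rewrite -[v]scale1r; apply: PD.
by rewrite -[_ *: _]addr0; apply: PD.
Qed.

Lemma sch_lie_alt u : sch_lie u u = 0.
Proof.
elim/sch_base_ind: u => [|c u v uu vv|a]; first exact: sch_lie0l.
  rewrite !(sch_lieDl, sch_lieDr, sch_lieZl, sch_lieZr) uu vv (sch_lieC v u).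
  by rewrite !scaler0 add0r addr0 scalerN addrN.
rewrite sch_lie_baseE; case: a => [||||i|i|j k lt_jk] //=.
have ne_jk : (j == k) = false by apply/eqP => e; move: lt_jk; rewrite e ltnn.
by rewrite ne_jk !scale0r !sch_s0 !scaler0 !addr0.
Qed.

Lemma sch_lie_jacobi u v w :
  sch_lie u (sch_lie v w) + sch_lie v (sch_lie w u) + sch_lie w (sch_lie u v)
    = 0.
Proof.
pose code a : kind n := match a with
  | IE => KE n | IF => KF n | IH => KH n | IZ => KZ n
  | IX i => KX i | IY i => KY i | IS j k _ => KS j k end.
apply: (@basis_jacobi K (schrodinger K n) _ n (fun t u => u t) _ _ _ sch_lie
  sch_e sch_f sch_h sch_z sch_x sch_y sch_s _ _ _ _ _ _ _ _ _ _ _ _ _ _ _ _ _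
  _ _ _ _ _ _ _ _ sch_base code).
- by move=> t u1 u2; rewrite ffunE.
- by move=> t c u1; rewrite ffunE.
- by move=> u1 u0; apply/ffunP => t; rewrite u0 ffunE.
- exact: sch_lieDl.
- exact: sch_lieZl.
- exact: sch_lieC.
- exact: sch_lie_alt.
- exact: sch_sC.
- exact: sch_lie_zl.
- exact: sch_lie_ef.
- exact: sch_lie_he.
- exact: sch_lie_fh.
- exact: sch_lie_xx.
- exact: sch_lie_xy.
- exact: sch_lie_yy.
- exact: sch_lie_ex.
- exact: sch_lie_ey.
- exact: sch_lie_fx.
- exact: sch_lie_fy.
- exact: sch_lie_hx.
- exact: sch_lie_hy.
- exact: sch_lie_se.
- exact: sch_lie_sf.
- exact: sch_lie_sh.
- exact: sch_lie_sx.
- exact: sch_lie_sy.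
- exact: sch_lie_ss.
- by case=> //= j k lt_jk; rewrite sch_sE.
- by move=> u1; exists u1; apply: sch_base_sum.
Qed.

End Schrodinger.

HB.instance Definition _ (K : fieldType) n :=
  Lmodule_isLieAlgebra.Build K (schrodinger K n) (@sch_lie_linearl K n)
    (@sch_lie_linearr K n) (@sch_lie_alt K n) (@sch_lie_jacobi K n).

(* Main.v *)
From HB Require Import structures.
Require Import Defs.
From mathcomp Require Import all_boot all_order all_algebra.
From mathcomp Require Import complex reals.
From mathcomp Require Import ring.
Local Open Scope ring_scope.

Set Implicit Arguments.
Unset Strict Implicit.
Unset Printing Implicit Defensive.
Import GRing.Theory Num.Theory.

(** In a transposed Poisson structure every multiplication operator
    [D = m w] is a half-derivation: [2 D[u,v] = [Du,v] + [u,Dv]].  The theorem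
    is read off from the half-derivations of the Schrödinger algebra.

    Applying a half-derivation to [[h,u] = k u] gives
    [2k Du - [h,Du] = [Dh,u]].  For [u = e] and [u = f] this determines
    [De] and [Df] from [Dh], and putting the result into [[e,f] = h] forces
    [Dh = c h] ([half_derivation_h]).  The identity is a half-derivation, so
    [D - c] is one that kills [h]; it then sends an eigenvector of [ad h] of
    eigenvalue [k] to one of eigenvalue [2k].  Since the eigenvalues are
    0, 1, -1, 2, -2, this kills [e] and [f], leaves [x_i] and [y_i] almost no
    room, and the brackets with [e] and [f] kill these too, hence also
    [z = [x_i,y_i]].  What [s_jk] is sent to commutes with [e], [f] and all
    [x_i], hence lies on the line of [z].  So [D - c] takes values in the centre
    ([half_derivation_range]), and it kills every bracket of two [s]'s.

    Thus [m u v = c(u) v] modulo [z].  Commutativity compares a multiple of [u]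
    with a multiple of [v], which forces [c = 0]: all operators [m u] kill [h]
    ([tp_mul_h]).  If [n <> 2], each [s_jk] is a bracket of two [s]'s and so
    [m = 0].  If [n = 2], the element [s_12] is not in the derived algebra, and
    the only freedom left is the number [c] in [m s_12 s_12 = c z]
    ([tp_mul_sch2]).  The grading with [x_i], [y_i] in degree 1 and [z] in
    degree 2 gives automorphisms scaling [z] by any [t ^ 2]; as complex numbers
    have square roots, [c] can be normalised to 1. *)

(** * Half-derivations and transposed Poisson structures on a Lie algebra *)

Definition half_derivation (K : fieldType) (L : lieAlgType K) (D : L -> L) :=
  forall u v, 2 *: D (lie u v) = lie (D u) v + lie u (D v).

HB.instance Definition _ (K : fieldType) (L : lieAlgType K)
    (m : transposed_poisson L) (w : L) :=
  GRing.isLinear.Build K L L _ (tp_mul m w) (tp_linearr m w).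

Lemma half_derivation_tp_mul (K : fieldType) (L : lieAlgType K)
  (m : transposed_poisson L) (w : L) : half_derivation (m w).
Proof. by move=> u v; apply: tp_compat. Qed.

(** The source of the exceptional structure: a functional that vanishes on the
    derived algebra and a central vector that it kills.  Both sides of the
    compatibility condition are then zero, and so are all triple products. *)
Section RankOne.
Variables (K : fieldType) (L : lieAlgType K) (phi : {scalar L}) (z : L).
Hypothesis phi_lie : forall u v, phi (lie u v) = 0.
Hypothesis phi_z : phi z = 0.
Hypothesis lie_zl : forall u, lie z u = 0.
Hypothesis lie_zr : forall u, lie u z = 0.

Definition rank_one_mul (u v : L) : L := (phi u * phi v) *: z.

Lemma rank_one_linearl v : linear (rank_one_mul^~ v).
Proof.
by move=> c u1 u2; rewrite /rank_one_mul linearP mulrDl scalerDl -mulrA -scalerA.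
Qed.

Lemma rank_one_commutative : commutative rank_one_mul.
Proof. by move=> u v; rewrite /rank_one_mul mulrC. Qed.

Lemma rank_one_linearr u : linear (rank_one_mul u).
Proof.
by move=> c v1 v2; rewrite ![rank_one_mul u _]rank_one_commutative rank_one_linearl.
Qed.

Lemma rank_one_associative : associative rank_one_mul.
Proof.
by move=> u v w; rewrite /rank_one_mul !linearZ_LR phi_z !(mulr0, mul0r).
Qed.

Lemma rank_one_compat u v w :
  2 *: rank_one_mul w (lie u v)
    = lie (rank_one_mul w u) v + lie u (rank_one_mul w v).
Proof.
have lieZl c x y : lie (c *: x) y = c *: lie x y :> L.
  have l0 : lie 0 y = 0 :> L.
    by have := lie_linearl y (-1) 0 0; rewrite scaler0 addr0 scaleN1r addNr.
  by have := lie_linearl y c x 0; rewrite l0 !addr0.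
have lieZr c x y : lie x (c *: y) = c *: lie x y :> L.
  have l0 : lie x 0 = 0 :> L.
    by have := lie_linearr x (-1) 0 0; rewrite scaler0 addr0 scaleN1r addNr.
  by have := lie_linearr x c y 0; rewrite l0 !addr0.
by rewrite /rank_one_mul phi_lie mulr0 scale0r lieZl lieZr lie_zl lie_zr !scaler0 addr0.
Qed.

Definition rank_one_tp : transposed_poisson L :=
  TransposedPoisson rank_one_linearl rank_one_linearr rank_one_commutative
    rank_one_associative rank_one_compat.

End RankOne.

(** * Coordinates in the Schrödinger algebra *)

(** The equality test inherited from the encoding of indices goes through
    ordinals and does not reduce on constructors; this one does, so that
    coordinates of basis vectors can be computed by simplification. *)
Definition sch_index_eqb (n : nat) (a b : sch_index n) : bool :=
  match a, b with
  | IE, IE | IF, IF | IH, IH | IZ, IZ => true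
  | IX i, IX j | IY i, IY j => i == j
  | IS j k _, IS l m _ => (j == l) && (k == m)
  | _, _ => false
  end.

Lemma sch_index_eqE (n : nat) (a b : sch_index n) : (a == b) = sch_index_eqb a b.
Proof.
apply/eqP/idP => [<-|]; first by case: a => //= *; rewrite !eqxx.
case: a => [||||i|i|j k jk]; case: b => [||||i'|i'|l m lm] //=.
- by move/eqP->.
- by move/eqP->.
- case/andP=> /eqP jl /eqP km; case: _ / jl lm => lm; case: _ / km lm => lm.
  by rewrite (bool_irrelevance jk lm).
Qed.

Definition sch_index_is_s (n : nat) (a : sch_index n) : bool :=
  if a is IS _ _ _ then true else false.

Lemma sch_index_is_sP (n : nat) (a : sch_index n) : sch_index_is_s a ->
  exists (j k : 'I_n) (jk : (j < k)%N), a = IS jk.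
Proof. by case: a => // j k jk _; exists j, k, jk. Qed.

Section Coordinates.
Variables (K : fieldType) (n : nat).
Implicit Types (u v : schrodinger K n) (a b c : sch_index n).

Lemma sch_baseE a b : sch_base K a b = (sch_index_eqb a b)%:R.
Proof. by rewrite ffunE sch_index_eqE. Qed.

Lemma sch_coord0 c : (0 : schrodinger K n) c = 0.
Proof. by rewrite ffunE. Qed.

Lemma sch_coordD u v c : (u + v) c = u c + v c.
Proof. by rewrite ffunE. Qed.

Lemma sch_coordN u c : (- u) c = - u c.
Proof. by rewrite ffunE. Qed.

Lemma sch_coordZ (k : K) u c : (k *: u) c = k * u c.
Proof. by rewrite ffunE. Qed.

Definition sch_coordE := (sch_coord0, sch_coordD, sch_coordN, sch_coordZ, sch_baseE).

Lemma sch_lieE u v : lie u v = sch_lie u v.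
Proof. by []. Qed.

(** The eigenvalues of [ad h] on the basis. *)
Definition sch_weight a : int :=
  match a with IE => 2 | IF => -2 | IX _ => 1 | IY _ => -1 | _ => 0 end.

Lemma sch_ad_hE u c : sch_lie (sch_h K n) u c = (sch_weight c)%:~R * u c.
Proof.
elim/sch_base_ind: u c => [|k u v IHu IHv|a] c.
- by rewrite sch_lie0r !sch_coordE mulr0.
- by rewrite sch_lieDr sch_lieZr !sch_coordE IHu IHv mulrDr mulrCA.
rewrite /sch_h sch_lie_baseE.
by case: a => [||||i|i|j k jk]; case: c => [||||i'|i'|l m lm];
  rewrite /= ?sch_coordE /=; ring.
Qed.

Lemma sch_ad_eE u c : sch_lie (sch_e K n) u c =
  match c with IE => -2 * u IH | IH => u IF | IX i => u (IY i) | _ => 0 end.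
Proof.
elim/sch_base_ind: u c => [|k u v IHu IHv|a] c.
- by rewrite sch_lie0r; case: c => *; rewrite !sch_coordE ?mulr0.
- rewrite sch_lieDr sch_lieZr !sch_coordE IHu IHv.
  by case: c => *; rewrite ?sch_coordE; ring.
rewrite /sch_e sch_lie_baseE.
by case: a => [||||i|i|j k jk]; case: c => [||||i'|i'|l m lm];
  rewrite /= ?sch_coordE /=; ring.
Qed.

Lemma sch_ad_fE u c : sch_lie (sch_f K n) u c =
  match c with IF => 2 * u IH | IH => - u IE | IY i => u (IX i) | _ => 0 end.
Proof.
elim/sch_base_ind: u c => [|k u v IHu IHv|a] c.
- by rewrite sch_lie0r; case: c => *; rewrite !sch_coordE ?(mulr0, oppr0).
- rewrite sch_lieDr sch_lieZr !sch_coordE IHu IHv.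
  by case: c => *; rewrite ?sch_coordE; ring.
rewrite /sch_f sch_lie_baseE.
by case: a => [||||i|i|j k jk]; case: c => [||||i'|i'|l m lm];
  rewrite /= ?sch_coordE /=; ring.
Qed.

(** The elements [x_k] detect the [s]-part of a vector: among the basis vectors
    only [s_jk] sends [x_k] to a vector with an [x_j]-component, for [j < k]. *)
Lemma sch_lie_x_coord u (j k : 'I_n) (jk : (j < k)%N) :
  sch_lie u (sch_x K k) (IX j) = u (IS jk).
Proof.
have nkj : (k == j) = false by apply/eqP => E; move: jk; rewrite E ltnn.
elim/sch_base_ind: u => [|c u v IHu IHv|a].
- by rewrite sch_lie0l !sch_coordE.
- by rewrite sch_lieDl sch_lieZl !sch_coordE IHu IHv.
rewrite /sch_x sch_lie_baseE.
case: a => [||||i|i|l m lm]; rewrite /= ?sch_coordE /= ?nkj ?(mulr0, oppr0) //.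
have [lk|_] := eqVneq l k; last by rewrite mul0r subr0 mulrC -natrM mulnb.
have -> : (m == j) = false.
  by apply/eqP => mj; move: lm; rewrite mj lk ltnNge (ltnW jk).
by rewrite lk nkj /= !mulr0 subr0.
Qed.

End Coordinates.

(** * Half-derivations of the Schrödinger algebra *)

Section HalfDerivation.
Variables (K : numFieldType) (n : nat).
Implicit Types (u v : schrodinger K n).
Implicit Types D : {linear schrodinger K n -> schrodinger K n}.

Lemma sch_eigenvector_coord0 (k : int) u (a : sch_index n) :
  sch_lie (sch_h K n) u = k%:~R *: u -> sch_weight a != k -> u a = 0.
Proof.
move=> /ffunP /(_ a); rewrite sch_ad_hE sch_coordZ => /eqP.
rewrite -subr_eq0 -mulrBl mulf_eq0 subr_eq0 eqr_int.
by move=> /orP[-> //|/eqP].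
Qed.

Lemma natr_mul_eq0 (k : nat) (x : K) : k.+1%:R * x = 0 -> x = 0.
Proof. by move/eqP; rewrite mulf_eq0 pnatr_eq0 => /eqP. Qed.

(** The brackets [[h,e]], [[h,f]] express the components of [De] and [Df] through
    those of [Dh]; substituting in [2 Dh = [De,f] + [e,Df]], each component of
    [Dh] off [h] comes out as a fixed multiple of itself (1/4 on [e] and [f],
    1/6 on [x_i] and [y_i], 0 on the rest), so it vanishes. *)
Lemma half_derivation_h D : half_derivation D ->
  D (sch_h K n) = D (sch_h K n) IH *: sch_h K n.
Proof.
have hE c : sch_h K n c = (sch_index_eqb IH c)%:R := sch_baseE K IH c.
move: hE (@sch_ad_eE K n) (@sch_ad_fE K n) (@sch_ad_hE K n)
  (sch_lie_ef K n) (sch_lie_he K n) (sch_lie_fh K n).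
(* From here on only the brackets of e, f, h and their adjoint actions matter. *)
move: (sch_e K n) (sch_f K n) (sch_h K n) => e f h hE ad_e ad_f ad_h ef he fh hD.
have De c : (4 - (sch_weight c)%:~R) * D e c = - sch_lie e (D h) c.
  have /ffunP /(_ c) := hD h e.
  rewrite !sch_lieE he linearZ_LR (sch_lieC (D h)) !sch_coordE ad_h.
  by move/eqP; rewrite -subr_eq => /eqP <-; ring.
have Df c : (4 + (sch_weight c)%:~R) * D f c = sch_lie f (D h) c.
  have /ffunP /(_ c) := hD f h.
  rewrite !sch_lieE fh linearZ_LR (sch_lieC (D f)) !sch_coordE ad_h.
  by rewrite addrC => /eqP; rewrite -subr_eq => /eqP <-; ring.
have Dh c : 2 * D h c = sch_lie e (D f) c - sch_lie f (D e) c.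
  have /ffunP /(_ c) := hD e f.
  by rewrite !sch_lieE ef (sch_lieC (D e)) !sch_coordE addrC.
move: (D h) De Df Dh => dh De Df Dh.
apply/ffunP => c; rewrite sch_coordZ hE.
case: c => [||||i|i|j k jk] /=; rewrite ?mulr1 // ?mulr0.
- have := Df IH; have := Dh IE; rewrite !ad_e !ad_f /= => E1 E2.
  apply: (@natr_mul_eq0 2).
  transitivity (2 * (2 * dh IE) + - dh IE); first by ring.
  by rewrite E1 -E2; ring.
- have := De IH; have := Dh IF; rewrite !ad_e !ad_f /= => E1 E2.
  apply: (@natr_mul_eq0 2).
  transitivity (2 * (2 * dh IF) + - dh IF); first by ring.
  by rewrite E1 -E2; ring.
- have := Dh IZ; rewrite ad_e ad_f subrr; exact: (@natr_mul_eq0 1).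
- have := Df (IY i); have := Dh (IX i); rewrite !ad_e !ad_f /= => E1 E2.
  apply: (@natr_mul_eq0 4).
  transitivity (3 * (2 * dh (IX i)) - dh (IX i)); first by ring.
  by rewrite E1 -E2; ring.
- have := De (IX i); have := Dh (IY i); rewrite !ad_e !ad_f /= => E1 E2.
  apply: (@natr_mul_eq0 4).
  transitivity (3 * (2 * dh (IY i)) + - dh (IY i)); first by ring.
  by rewrite E1 -E2; ring.
- have := Dh (IS jk); rewrite ad_e ad_f subrr; exact: (@natr_mul_eq0 1).
Qed.

Section KillsH.
Variable D : {linear schrodinger K n -> schrodinger K n}.
Hypotheses (hD : half_derivation D) (Dh0 : D (sch_h K n) = 0).

(** Weights double, so a vector of weight [k] is killed whenever [2k] is not a
    weight. *)
Lemma half_derivation_eigenvector (k : int) u : lie (sch_h K n) u = k%:~R *: u ->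
  sch_lie (sch_h K n) (D u) = (2 * k)%:~R *: D u.
Proof.
move=> hu; have := hD (sch_h K n) u.
by rewrite hu Dh0 linearZ_LR scalerA !sch_lieE sch_lie0l add0r intrM.
Qed.

Lemma half_derivation_e0 : D (sch_e K n) = 0.
Proof.
apply/ffunP => c; rewrite sch_coord0.
apply: (sch_eigenvector_coord0 (half_derivation_eigenvector (k := 2) _)).
  exact: sch_lie_he.
by case: c.
Qed.

Lemma half_derivation_f0 : D (sch_f K n) = 0.
Proof.
apply/ffunP => c; rewrite sch_coord0.
apply: (sch_eigenvector_coord0 (half_derivation_eigenvector (k := -2) _)).
  by rewrite sch_lieE sch_lieC sch_lie_fh -scaleNr.
by case: c.
Qed.

(** [D y_i] has weight -2, so it is a multiple of [f]; but
    [2 D y_i = [f, D x_i]], and [D x_i], of weight 2, is a multiple of [e], so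
    that this bracket is a multiple of [h]. *)
Lemma half_derivation_y0 i : D (sch_y K i) = 0.
Proof.
apply/ffunP => c; rewrite sch_coord0.
have hx a : sch_weight a != 2 -> D (sch_x K i) a = 0.
  apply: (sch_eigenvector_coord0 (half_derivation_eigenvector (k := 1) _)).
  by rewrite sch_lieE sch_lie_hx scale1r.
have [cF|] := eqVneq (sch_weight c) (-2); last first.
  apply: (sch_eigenvector_coord0 (half_derivation_eigenvector (k := -1) _)).
  by rewrite sch_lieE sch_lie_hy scaleN1r.
have -> : c = IF by case: c cF.
have := hD (sch_f K n) (sch_x K i).
rewrite half_derivation_f0 !sch_lieE sch_lie_fx sch_lie0l add0r => /ffunP /(_ IF).
by rewrite sch_coordZ sch_ad_fE hx // mulr0; apply: (@natr_mul_eq0 1).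
Qed.

Lemma half_derivation_x0 i : D (sch_x K i) = 0.
Proof.
have := hD (sch_e K n) (sch_y K i).
rewrite half_derivation_e0 half_derivation_y0 !sch_lieE sch_lie_ey sch_lie0l sch_lie0r.
by rewrite addr0 => /eqP; rewrite scaler_eq0 pnatr_eq0 => /eqP.
Qed.

Lemma half_derivation_z0 (i : 'I_n) : D (sch_z K n) = 0.
Proof.
have := hD (sch_x K i) (sch_y K i).
rewrite half_derivation_x0 half_derivation_y0 !sch_lieE sch_lie_xy eqxx scale1r.
by rewrite sch_lie0l sch_lie0r addr0 => /eqP; rewrite scaler_eq0 pnatr_eq0 => /eqP.
Qed.

(** [D s_jk] centralises [e] and [f], which leaves only the [s] and [z]
    components, and then it centralises all [x_i], which kills the former:
    rotations act faithfully on the [x_i]. *)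
Lemma half_derivation_s j k : D (sch_s K j k) = D (sch_s K j k) IZ *: sch_z K n.
Proof.
have D_kills u : D u = 0 -> lie u (sch_s K j k) = 0 ->
    sch_lie u (D (sch_s K j k)) = 0.
  move=> Du us; have := hD u (sch_s K j k).
  by rewrite us Du linear0 scaler0 !sch_lieE sch_lie0l add0r.
have ad_e c : sch_lie (sch_e K n) (D (sch_s K j k)) c = 0.
  rewrite D_kills ?sch_coord0 ?half_derivation_e0 //.
  by rewrite sch_lieE sch_lieC sch_lie_se oppr0.
have ad_f c : sch_lie (sch_f K n) (D (sch_s K j k)) c = 0.
  rewrite D_kills ?sch_coord0 ?half_derivation_f0 //.
  by rewrite sch_lieE sch_lieC sch_lie_sf oppr0.
have ad_x i : sch_lie (D (sch_s K j k)) (sch_x K i) = 0.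
  move: half_derivation_x0 (@sch_lie_sx K n j k).
  move: (@sch_x K n) (sch_s K j k) => x s x0 sx; have := hD s (x i).
  rewrite !sch_lieE sx (linearB D) !(linearZ_LR D) !x0 sch_lie0r addr0.
  by rewrite !scaler0 subrr scaler0.
apply/ffunP => c; rewrite !sch_coordE.
case: c => [||||i|i|l m lm] /=; rewrite ?mulr1 // ?mulr0.
- by have := ad_f IH; rewrite sch_ad_fE => /eqP; rewrite oppr_eq0 => /eqP.
- by have := ad_e IH; rewrite sch_ad_eE.
- by have := ad_f IF; rewrite sch_ad_fE; apply: (@natr_mul_eq0 1).
- by have := ad_f (IY i); rewrite sch_ad_fE.
- by have := ad_e (IX i); rewrite sch_ad_eE.
- by rewrite -sch_lie_x_coord ad_x sch_coord0.
Qed.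

Lemma half_derivation_central u v :
  D u = D u IZ *: sch_z K n -> D v = D v IZ *: sch_z K n -> D (lie u v) = 0.
Proof.
move=> Du Dv; apply/eqP; have /eqP := hD u v.
rewrite Du Dv !sch_lieE sch_lieZl sch_lieZr sch_lie_zl sch_lie_zr !scaler0 addr0.
by rewrite scaler_eq0 pnatr_eq0.
Qed.

Lemma half_derivation_base0 (i : 'I_n) a :
  ~~ sch_index_is_s a -> D (sch_base K a) = 0.
Proof.
case: a => [||||j|j|j k jk] aS; last by case/negP: aS.
- exact: half_derivation_e0.
- exact: half_derivation_f0.
- exact: Dh0.
- exact: half_derivation_z0.
- exact: half_derivation_x0.
- exact: half_derivation_y0.
Qed.

Lemma half_derivation_range (i : 'I_n) u : D u = D u IZ *: sch_z K n.
Proof.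
elim/sch_base_ind: u => [|c u v IHu IHv|a].
- by rewrite linear0 sch_coord0 scale0r.
- by rewrite linearP {1}IHu {1}IHv scalerA -scalerDl sch_coordD sch_coordZ.
have [/sch_index_is_sP[j [k [jk ->]]]|/(half_derivation_base0 i)->] :=
  boolP (sch_index_is_s a).
  by rewrite -sch_sE; apply: half_derivation_s.
by rewrite sch_coord0 scale0r.
Qed.

Lemma half_derivation_eq0 (i : 'I_n) : (forall j k, D (sch_s K j k) = 0) ->
  forall u, D u = 0.
Proof.
move=> Ds; elim/sch_base_ind => [|c u v Du Dv|a]; first exact: linear0.
  by rewrite linearP Du Dv scaler0 addr0.
have [/sch_index_is_sP[j [k [jk ->]]]|aS] := boolP (sch_index_is_s a).
  by rewrite -sch_sE.
exact: half_derivation_base0.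
Qed.

End KillsH.

Lemma half_derivation_subZ D (c : K) : half_derivation D ->
  half_derivation (D \- c \*: idfun).
Proof.
move=> hD u v; rewrite /= scalerBr hD !sch_lieE.
rewrite sch_lieDl sch_lieDr sch_lieNl sch_lieNr sch_lieZl sch_lieZr.
by rewrite scaler_nat mulr2n opprD addrACA.
Qed.

End HalfDerivation.

(** * Multiplication operators on the Schrödinger algebra *)

Section TransposedPoisson.
Variables (K : numFieldType) (n : nat) (i : 'I_n).
Variable m : transposed_poisson (schrodinger K n).
Implicit Types (u v : schrodinger K n).

Lemma tp_mul_mod_z u v a : a != IZ -> m u v a = m u (sch_h K n) IH * v a.
Proof.
move=> aZ; set c := m u _ IH.
have hD := half_derivation_subZ c (half_derivation_tp_mul m u).
have Dh0 : (m u \- c \*: idfun) (sch_h K n) = 0.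
  by rewrite /= (half_derivation_h (half_derivation_tp_mul m u)) subrr.
have /ffunP /(_ a) := half_derivation_range hD Dh0 i v.
rewrite /= !sch_coordE => /eqP; rewrite subr_eq => /eqP ->.
by move: aZ; case: a => [||||j|j|j k jk]; rewrite ?eqxx //= mulr0 add0r.
Qed.

Lemma tp_mul_h_line u : m u (sch_h K n) = m u (sch_h K n) IH *: sch_h K n.
Proof. exact: half_derivation_h (half_derivation_tp_mul m u). Qed.

(** Write [c(u)] for the [h]-coordinate of [m u h].  Off [z] one has
    [m u v = c(u) v] and, by commutativity, also [m u v = c(v) u]; comparing for
    [u = h], [v = e] gives [c(h) = 0], and then for [v = h] gives [c(u) = 0]. *)
Lemma tp_mul_h u : m u (sch_h K n) = 0.
Proof.
have IEZ : (IE : sch_index n) != IZ by rewrite sch_index_eqE.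
have IHZ : (IH : sch_index n) != IZ by rewrite sch_index_eqE.
have eE : sch_e K n IE = 1 := sch_baseE K IE IE.
have hE : sch_h K n IE = 0 := sch_baseE K IH IE.
move: eE hE (fun u v => tp_mul_mod_z u v IEZ) (fun u v => tp_mul_mod_z u v IHZ)
  tp_mul_h_line.
move: (sch_e K n) (sch_h K n) => e h eE hE modE modH line.
have c_h : m h h IH = 0.
  have := modE h e; rewrite eE mulr1 => <-.
  by rewrite tp_commutative line sch_coordZ hE mulr0.
by rewrite line tp_commutative modH c_h mul0r scale0r.
Qed.

(** As soon as there is an [s_jk] and [n <> 2], there is a third index [l], and
    [s_jk = [s_jl, s_lk]] is killed as a bracket of vectors with central image.
    For [n = 1] there is no [s_jk] to consider. *)
Lemma tp_mul_eq0 : n <> 2%N -> tp_trivial m.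
Proof.
move=> n2 u; have hD := half_derivation_tp_mul m u.
apply: (half_derivation_eq0 hD (tp_mul_h u) i) => j k.
have [->|jk] := eqVneq j k; first by rewrite sch_s0 linear0.
have [l /andP[lj lk]] : exists l, (l != j) && (l != k).
  apply/existsP; apply: contra_notT n2; rewrite negb_exists => /forallP nl.
  suff : [set: 'I_n] = [set j; k].
    move/(congr1 (fun A : {set _} => #|A|)).
    by rewrite cardsT card_ord cards2 jk.
  by apply/setP => l; rewrite !inE; have := nl l; rewrite negb_and !negbK => ->.
have -> : sch_s K j k = lie (sch_s K j l) (sch_s K l k).
  rewrite sch_lieE sch_lie_ss eqxx [k == l]eq_sym (negPf lj) (negPf lk) (negPf jk).
  by rewrite scale1r !scale0r !addr0.
by apply: (half_derivation_central hD); apply: half_derivation_s hD (tp_mul_h u) _ _.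
Qed.

End TransposedPoisson.

(** * Structures on the Schrödinger algebra with n = 2 *)

Section Two.
Variable K : fieldType.
Implicit Types u v : schrodinger K 2.

Definition sch_s12 : schrodinger K 2 := sch_s K ord0 ord_max.

Definition lt01 : ((ord0 : 'I_2) < (ord_max : 'I_2))%N := isT.

Lemma sch_index2_s (j k : 'I_2) (jk : (j < k)%N) : IS jk = IS lt01.
Proof.
apply/eqP; rewrite sch_index_eqE /=.
by case: j k jk => [[|[|?]] ?] [[|[|?]] ?].
Qed.

Definition s12_coord u : K := u (IS lt01).

Lemma s12_coord_linear : scalar s12_coord.
Proof. by move=> c u v; rewrite /s12_coord !sch_coordE. Qed.

HB.instance Definition _ :=
  GRing.isLinear.Build K (schrodinger K 2) K *%R s12_coord s12_coord_linear.

(** [s_12] spans the abelian rotation algebra [so_2], which no bracket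
    reaches. *)
Lemma s12_coord_lie u v : s12_coord (lie u v) = 0.
Proof.
rewrite sch_lieE; elim/sch_base_ind: u => [|c u1 u2 IH1 IH2|a].
- by rewrite sch_lie0l linear0.
- by rewrite sch_lieDl sch_lieZl linearP /= IH1 IH2 mulr0 addr0.
elim/sch_base_ind: v => [|c v1 v2 IH1 IH2|b].
- by rewrite sch_lie0r linear0.
- by rewrite sch_lieDr sch_lieZr linearP /= IH1 IH2 mulr0 addr0.
case: a => [||||i|i|j k jk]; case: b => [||||i'|i'|j' k' jk']; last first.
  by rewrite !sch_index2_s sch_lie_alt linear0.
all: by rewrite sch_lie_baseE /s12_coord /= ?sch_coordE /=; ring.
Qed.

Lemma s12_coord_z : s12_coord (sch_z K 2) = 0.
Proof. by rewrite /s12_coord sch_baseE. Qed.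

Definition sch2_tp : transposed_poisson (schrodinger K 2) :=
  rank_one_tp s12_coord_lie s12_coord_z (@sch_lie_zl K 2) (@sch_lie_zr K 2).

Lemma sch2_tpE u v : sch2_tp u v = (s12_coord u * s12_coord v) *: sch_z K 2.
Proof. by []. Qed.

Lemma sch_s12E : sch_s12 = sch_base K (IS lt01).
Proof. exact: sch_sE. Qed.

Lemma sch2_tp_s12 : sch2_tp sch_s12 sch_s12 = sch_z K 2.
Proof.
have s1 : s12_coord sch_s12 = 1 by rewrite sch_s12E /s12_coord sch_baseE.
by rewrite sch2_tpE s1 mulr1 scale1r.
Qed.

Lemma sch2_tp_base0 (a b : sch_index 2) :
  ~ (sch_base K a = sch_s12 /\ sch_base K b = sch_s12) ->
  sch2_tp (sch_base K a) (sch_base K b) = 0.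
Proof.
rewrite sch2_tpE /s12_coord !ffunE sch_s12E => nab.
have [aS|_] := eqVneq a; last by rewrite mul0r scale0r.
have [bS|_] := eqVneq b; last by rewrite mulr0 scale0r.
by case: nab; rewrite aS bS.
Qed.

Lemma sch2_tp_nontrivial : ~ tp_trivial sch2_tp.
Proof.
move=> /(_ sch_s12 sch_s12); rewrite sch2_tp_s12 => /ffunP /(_ IZ) /eqP.
by rewrite sch_baseE sch_coord0 oner_eq0.
Qed.

End Two.

(** Every [m w] kills all basis vectors but [s_12], so by bilinearity and
    commutativity [m] is determined by [m s_12 s_12], a multiple of [z]. *)
Lemma tp_mul_sch2 (K : numFieldType) (m : transposed_poisson (schrodinger K 2)) u v :
  m u v = m (sch_s12 K) (sch_s12 K) IZ *: sch2_tp K u v.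
Proof.
have mE w x : m w x = s12_coord x *: m w (sch_s12 K).
  have Dh0 := tp_mul_h ord0 m w.
  elim/sch_base_ind: x => [|c x1 x2 IH1 IH2|a].
  - by rewrite !linear0 scale0r.
  - by rewrite !linearP /= IH1 IH2 scalerDl scalerA.
  have [/sch_index_is_sP[j [k [jk ->]]]|aS] := boolP (sch_index_is_s a).
    rewrite sch_index2_s /sch_s12 (sch_sE _ lt01).
    by rewrite /s12_coord sch_baseE scale1r.
  rewrite (half_derivation_base0 (half_derivation_tp_mul m w) Dh0 ord0 aS).
  have -> : s12_coord (sch_base K a) = 0.
    by rewrite /s12_coord sch_baseE; case: a aS.
  by rewrite scale0r.
have mss : m (sch_s12 K) (sch_s12 K) = m (sch_s12 K) (sch_s12 K) IZ *: sch_z K 2.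
  exact: half_derivation_s (half_derivation_tp_mul m _) (tp_mul_h ord0 m _) _ _.
have -> : m u v = (s12_coord u * s12_coord v) *: m (sch_s12 K) (sch_s12 K).
  by rewrite mE tp_commutative mE scalerA mulrC.
by rewrite {1}mss sch2_tpE !scalerA mulrC.
Qed.

(** * Dilations and the classification for n = 2 *)

Section Dilation.
Variables (K : fieldType) (n : nat).
Implicit Types (u v : schrodinger K n) (t : K).

(** A grading of the Lie algebra: the Levi part [sl_2 + so_n] in degree 0, the
    Heisenberg generators in degree 1 and their bracket [z] in degree 2. *)
Definition sch_degree (a : sch_index n) : nat :=
  match a with IX _ | IY _ => 1 | IZ => 2 | _ => 0 end.

Definition sch_dilation t u : schrodinger K n := [ffun a => t ^+ sch_degree a * u a].

Lemma sch_dilation_coord t u a : sch_dilation t u a = t ^+ sch_degree a * u a.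
Proof. by rewrite ffunE. Qed.

Lemma sch_dilation_linear t : linear (sch_dilation t).
Proof.
move=> c u v; apply/ffunP => a.
by rewrite !(sch_coordE, sch_dilation_coord) mulrDr mulrCA.
Qed.

HB.instance Definition _ t :=
  GRing.isLinear.Build K (schrodinger K n) (schrodinger K n) _ (sch_dilation t)
    (sch_dilation_linear t).

Lemma sch_dilationK t : t != 0 -> cancel (sch_dilation t) (sch_dilation t^-1).
Proof.
move=> t0 u; apply/ffunP => a.
by rewrite !sch_dilation_coord mulrA exprVn mulVf ?mul1r ?expf_neq0.
Qed.

Lemma sch_dilation_base t a :
  sch_dilation t (sch_base K a) = t ^+ sch_degree a *: sch_base K a.
Proof.
apply/ffunP => b; rewrite sch_dilation_coord sch_coordZ ffunE.
by case: eqP => [->|_]; rewrite ?mulr0.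
Qed.

Lemma sch_dilation_z t : sch_dilation t (sch_z K n) = t ^+ 2 *: sch_z K n.
Proof. exact: sch_dilation_base. Qed.

Lemma sch_dilation_scale_z t k :
  sch_dilation t (k *: sch_z K n) = (k * t ^+ 2) *: sch_z K n.
Proof. by rewrite (linearZ_LR (sch_dilation t)) /= sch_dilation_z scalerA. Qed.

Lemma sch_dilation_s t j k : sch_dilation t (sch_s K j k) = sch_s K j k.
Proof.
apply: (sch_s_ind (P := fun u _ _ => sch_dilation t u = u)) => {j k} [j|j k|j k jk].
- exact: linear0.
- by rewrite linearN /= => ->.
- by rewrite sch_dilation_base scale1r.
Qed.

Lemma sch_dilation_lie t u v :
  sch_dilation t (lie u v) = lie (sch_dilation t u) (sch_dilation t v).
Proof.
pose dil : {linear schrodinger K n -> schrodinger K n} := sch_dilation t.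
rewrite !sch_lieE; elim/sch_base_ind: u => [|c u1 u2 IH1 IH2|a].
- by rewrite sch_lie0l !linear0 sch_lie0l.
- by rewrite sch_lieDl sch_lieZl !linearP /= IH1 IH2 sch_lieDl sch_lieZl.
elim/sch_base_ind: v => [|c v1 v2 IH1 IH2|b].
- by rewrite sch_lie0r !linear0 sch_lie0r.
- by rewrite sch_lieDr sch_lieZr !linearP /= IH1 IH2 sch_lieDr sch_lieZr.
rewrite !sch_dilation_base sch_lieZl sch_lieZr sch_lie_baseE scalerA -exprD.
have de : dil (sch_e K n) = 1 *: sch_e K n := sch_dilation_base t IE.
have df : dil (sch_f K n) = 1 *: sch_f K n := sch_dilation_base t IF.
have dh : dil (sch_h K n) = 1 *: sch_h K n := sch_dilation_base t IH.
have dz : dil (sch_z K n) = t ^+ 2 *: sch_z K n := sch_dilation_z t.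
have dx i : dil (sch_x K i) = t *: sch_x K i := sch_dilation_base t (IX i).
have dy i : dil (sch_y K i) = t *: sch_y K i := sch_dilation_base t (IY i).
have ds j k : dil (sch_s K j k) = sch_s K j k := sch_dilation_s t j k.
rewrite -/(dil _).
(* With the basis vectors abstracted, only linearity and homogeneity are left. *)
case: a => [||||i|i|j k jk]; case: b => [||||i'|i'|j' k' jk'] /=.
all: move: (sch_e K n) (sch_f K n) (sch_h K n) (sch_z K n) (@sch_x K n) (@sch_y K n)
  (@sch_s K n) de df dh dz dx dy ds => e f h z x y s de df dh dz dx dy ds.
all: rewrite ?(linear0 dil, linearN dil, linearD dil, linearZ_LR dil).
all: rewrite ?(de, df, dh, dz, dx, dy, ds).
all: by apply/ffunP => c; rewrite ?sch_coordE; ring.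
Qed.

Lemma sch_dilation_automorphism t : t != 0 -> lie_automorphism (sch_dilation t).
Proof.
move=> t0; split; last exact: sch_dilation_lie.
exists (sch_dilation t^-1); first exact: sch_dilationK.
by rewrite -{2}[t]invrK; apply: sch_dilationK; rewrite invr_eq0.
Qed.

End Dilation.

Lemma s12_coord_dilation (K : fieldType) (t : K) (u : schrodinger K 2) :
  s12_coord (sch_dilation t u) = s12_coord u.
Proof. by rewrite /s12_coord sch_dilation_coord mul1r. Qed.

(** If [m s_12 s_12 = c z], the dilation by [t] turns [c] into [c t ^ 2], because
    it fixes [s_12]; so [t] is taken with [t ^ 2 = 1 / c]. *)
Lemma sch2_tp_isomorphic (K : numClosedFieldType)
    (m : transposed_poisson (schrodinger K 2)) :
  ~ tp_trivial m -> tp_isomorphic m (sch2_tp K).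
Proof.
move=> m_nt; set c := m (sch_s12 K) (sch_s12 K) IZ.
have c0 : c != 0.
  by apply/eqP => c0; apply: m_nt => u v; rewrite tp_mul_sch2 -/c c0 scale0r.
pose t := (sqrtC c)^-1.
have t0 : t != 0 by rewrite invr_eq0 sqrtC_eq0.
have dil_mul u v : sch_dilation t (m u v)
    = sch2_tp K (sch_dilation t u) (sch_dilation t v).
  rewrite tp_mul_sch2 -/c !sch2_tpE scalerA sch_dilation_scale_z !s12_coord_dilation.
  by rewrite exprVn sqrtCK mulrAC divff // mul1r.
exists (sch_dilation t); last exact: dil_mul.
exact: sch_dilation_automorphism.
Qed.

Theorem theorem3p7 (R : realType) :
  (forall n : nat, (1 <= n)%N -> n <> 2%N ->
     forall m : transposed_poisson (schrodinger R[i] n), tp_trivial m)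
  /\
  (exists m : transposed_poisson (schrodinger R[i] 2),
     let s12 : schrodinger R[i] 2 := sch_s R[i] ord0 ord_max in
     [/\ m s12 s12 = sch_z R[i] 2,
         forall a b : sch_index 2,
           ~ (sch_base R[i] a = s12 /\ sch_base R[i] b = s12) ->
           m (sch_base R[i] a) (sch_base R[i] b) = 0,
         ~ tp_trivial m
       & forall m' : transposed_poisson (schrodinger R[i] 2),
           ~ tp_trivial m' -> tp_isomorphic m' m]).
Proof.
split=> [n n_gt0 n2 m|]; first exact: (tp_mul_eq0 (Ordinal n_gt0)).
exists (sch2_tp R[i]); split.
- exact: sch2_tp_s12.
- exact: sch2_tp_base0.
- exact: sch2_tp_nontrivial.
- exact: sch2_tp_isomorphic.
Qed.
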